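(* If there are at most $f$ faulty nodes in total and none of them is in layer $0$, then $\mathcal{L}_{\ell}\in O(5^f\kappa\log D)$ for all $\ell\in\mathbb{N}$.
   Context: $\mathbb{N}$ includes $0$; $\log=\log_2$. The constant in $O(\cdot)$ is absolute (independent of $f,D,\ell$ and all parameters), for $D$ large enough (asymptotics in $D$). Graph. $(V,E)$ is a finite simple connected base graph of minimum degree at least $2$ and diameter $D\in\mathbb{N}_{>0}$. The layered graph $G=(V_G,E_G)$ has nodes $(v,\ell)$, $v\in V$, $\ell\in\mathbb{N}$ (layer $\ell$), and directed edges $((w,\ell),(v,\ell+1))$ whenever $w=v$ or $\{v,w\}\in E$. The predecessors of $(v,\ell)$, $\ell\ge1$, are the $(w,\ell-1)$ with $w=v$ or $\{v,w\}\in E$. Faults. A set $F\subset V_G$ of nodes is faulty; the others are correct. No node has more than one faulty predecessor, i.e. $|(\{(v,\ell)\}\cup\{(w,\ell):\{v,w\}\in E\})\cap F|\le1$ for all $v,\ell$. Timing model. Reals $d$ (maximum delay), $0\le u\le d$, $\vartheta>1$, $\Lambda$ are given. Each edge $e$ of $G$ has a fixed delay $\delta_e\in[d-u,d]$. Each node has a hardware clock $H_{v,\ell}\colon\mathbb{R}_{\ge0}\to\mathbb{R}_{\ge0}$ with $t'-t\le H_{v,\ell}(t')-H_{v,\ell}(t)\le\vartheta(t'-t)$ for all $t<t'$, running at a constant rate. Algorithm. $t_{v,\ell}^k$ is the time of the $k$-th pulse of a correct node $(v,\ell)$. For $\ell\ge1$ it is determined as follows. For each predecessor $(w,\ell-1)$,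 let $r_w$ be the reception time at $(v,\ell)$ of its $k$-th pulse: $r_w=t_{w,\ell-1}^k+\delta_{((w,\ell-1),(v,\ell))}$ if $(w,\ell-1)$ is correct, while $r_w\in\mathbb{R}_{\ge0}\cup\{\infty\}$ is arbitrary ($\infty$ meaning no message; possibly different for different receivers and pulses) if $(w,\ell-1)$ is faulty. Put $h_w:=H_{v,\ell}(r_w)$ ($\infty$ if $r_w=\infty$), $H_{\mathrm{own}}:=h_v$, $H_{\min}:=\min_{\{v,w\}\in E}h_w$, $H_{\max}:=\max_{\{v,w\}\in E}h_w$. If $H_{\mathrm{own}}=\infty$, then $H_{v,\ell}(t_{v,\ell}^k)=H_{\max}+\tfrac{3\kappa}{2}+\Lambda-d$. Otherwise let $$\Delta:=\min_{s\in\mathbb{N}}\max\{H_{\mathrm{own}}-H_{\max}+4s\kappa,\;H_{\mathrm{own}}-H_{\min}-4s\kappa\}-\tfrac{\kappa}{2}$$ (with $\Delta:=-\infty$ if $H_{\max}=\infty$), let $\mathcal{C}_{v,\ell}:=\min\{H_{\mathrm{own}}-H_{\min}+\tfrac{3\kappa}{2},0\}$ if $\Delta<0$, $\mathcal{C}_{v,\ell}:=\Delta$ if $0\le\Delta\le\vartheta\kappa$, $\mathcal{C}_{v,\ell}:=\max\{H_{\mathrm{own}}-H_{\max}-\tfrac{3\kappa}{2},\vartheta\kappa\}$ if $\Delta>\vartheta\kappa$, and $H_{v,\ell}(t_{v,\ell}^k)=H_{\mathrm{own}}+\Lambda-d-\mathcal{C}_{v,\ell}$. Skew. $\mathcal{L}_{\ell}:=\sup_{k}\max\{|t_{v,\ell}^k-t_{w,\ell}^k|:\{v,w\}\in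 E,\ (v,\ell),(w,\ell)\notin F\}$. Layer $0$ is given as input with $\mathcal{L}_0\le\kappa$. Parameters. $\kappa:=2\left(u+\left(1-\frac1\vartheta\right)(\Lambda-d)\right)>0$. For a sufficiently large absolute constant $C_0$: $\Lambda\ge C_0\vartheta(\sup_{\ell}\mathcal{L}_\ell+u)+d$, $d\ge C_0(\vartheta(\sup_\ell\mathcal{L}_\ell+u)+\kappa)$, and $d\ge C_0(u+(\vartheta-1)d)$; these are required both for the execution considered and for the executions differing from it only in that some faulty nodes are correct. *)

(* Defs.v *)
From HB Require Import structures.
From mathcomp Require Import all_boot all_order all_algebra.
From mathcomp Require Import all_classical all_reals all_analysis.

Set Implicit Arguments.
Unset Strict Implicit.
Unset Printing Implicit Defensive.

Import Order.TTheory GRing.Theory Num.Theory.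

Local Open Scope classical_set_scope.
Local Open Scope ring_scope.

Definition walk (V : finType) (e : rel V) (n : nat) (x y : V) : bool :=
  [exists p : n.-tuple V, path e x p && (last x p == y)].

(* In a connected graph some walk of length less than #|V| joins x to y, so the
   default value #|V| is only taken for disconnected vertices. *)
Definition graph_dist (V : finType) (e : rel V) (x y : V) : nat :=
  \big[minn/#|V|]_(n < #|V| | walk e n x y) n.

Definition diameter (V : finType) (e : rel V) : nat :=
  (\max_(x : V) \max_(y : V) graph_dist e x y)%N.

Definition base_graph (V : finType) (e : rel V) : Prop :=
  [/\ symmetric e, irreflexive e, forall x y, connect e x y
    & forall v, (2 <= #|[set w | e v w]%SET|)%N].

(* (w, l) is a predecessor of (v, l.+1) iff pred_of e v w. *)
Definition pred_of (V : finType) (e : rel V) (v w : V) : bool :=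
  (w == v) || e v w.

Record params (R : realType) := Params {
  max_delay : R;      (* d *)
  uncertainty : R;    (* u *)
  theta : R;          (* maximum clock rate *)
  Lambda : R
}.

Definition kappa (R : realType) (p : params R) : R :=
  2 * (uncertainty p + (1 - (theta p)^-1) * (Lambda p - max_delay p)).

Definition valid_params (R : realType) (p : params R) : Prop :=
  [/\ 0 <= uncertainty p, uncertainty p <= max_delay p, 1 < theta p
    & 0 < kappa p].

Record execution (R : realType) (V : finType) := Execution {
  faulty : set (V * nat);
  (* delay w v l is the delay of the edge from (w, l) to (v, l.+1). *)
  delay : V -> V -> nat -> R;
  clock : V -> nat -> R -> R;
  (* message w v l k is the time at which (v, l.+1) receives the k-th pulse of
     (w, l), +oo if it never does; relevant only if (w, l) is faulty. *)
  message : V -> V -> nat -> nat -> \bar R;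
  (* pulse v l k is relevant only if (v, l) is correct. *)
  pulse : V -> nat -> nat -> R
}.

(* Only the restriction of a clock to nonnegative times is meaningful. *)
Definition hardware_clock (R : realType) (th : R) (H : R -> R) : Prop :=
  [/\ forall x, 0 <= x -> 0 <= H x,
      forall x y, 0 <= x -> x < y ->
        y - x <= H y - H x /\ H y - H x <= th * (y - x)
    & exists rate : R, forall x y, 0 <= x -> 0 <= y ->
        H y - H x = rate * (y - x)].

Definition reception (R : realType) (V : finType) (E : execution R V)
    (v : V) (l k : nat) (w : V) : \bar R :=
  if (w, l) \in faulty E then message E w v l k
  else (pulse E w l k + delay E w v l)%:E.

Definition local_reception (R : realType) (V : finType) (E : execution R V)
    (v : V) (l k : nat) (w : V) : \bar R :=
  if reception E v l k w is r%:E then (clock E v l.+1 r)%:E else +oo%E.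

Section Algorithm.
Local Open Scope ereal_scope.

(* For 0 < kap and finite hown, hmin, hmax the infimum is attained, hence is
   the minimum. *)
Definition discrepancy (R : realType) (kap : R) (hown hmin hmax : \bar R) :
    \bar R :=
  if hmax == +oo then -oo else
  ereal_inf (range (fun s : nat =>
    maxe (hown - hmax + (4 * s%:R * kap)%:E)
         (hown - hmin - (4 * s%:R * kap)%:E))) - (kap / 2)%:E.

Definition correction (R : realType) (th kap : R) (hown hmin hmax : \bar R) :
    \bar R :=
  let Delta := discrepancy kap hown hmin hmax in
  if Delta < 0 then mine (hown - hmin + (3 * kap / 2)%:E) 0
  else if Delta <= (th * kap)%:E then Delta
  else maxe (hown - hmax - (3 * kap / 2)%:E) (th * kap)%:E.

Definition pulse_local_time (R : realType) (p : params R)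
    (hown hmin hmax : \bar R) : \bar R :=
  if hown == +oo then
    hmax + (3 * kappa p / 2 + Lambda p - max_delay p)%:E
  else
    hown + (Lambda p - max_delay p)%:E
      - correction (theta p) (kappa p) hown hmin hmax.

Definition follows_algorithm (R : realType) (V : finType) (e : rel V)
    (p : params R) (E : execution R V) (v : V) (l k : nat) : Prop :=
  let h := local_reception E v l k in
  (clock E v l.+1 (pulse E v l.+1 k))%:E =
    pulse_local_time p (h v) (\big[mine/+oo]_(w | e v w) h w)
                             (\big[maxe/-oo]_(w | e v w) h w).

Definition valid_execution (R : realType) (V : finType) (e : rel V)
    (p : params R) (E : execution R V) : Prop :=
  [/\ forall v l, is_subset1 ([set (w, l) | w in pred_of e v] `&` faulty E),
      forall v w l, pred_of e v w ->
        (max_delay p - uncertainty p <= delay E w v l <= max_delay p)%R,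
      forall v l, hardware_clock (theta p) (clock E v l),
      forall v w l k, pred_of e v w -> faulty E (w, l) ->
        0 <= message E w v l k
    & (forall v l k, ~ faulty E (v, l) -> (0 <= pulse E v l k)%R) /\
      (forall v l k, ~ faulty E (v, l.+1) -> follows_algorithm e p E v l k)].

Definition layer_skew (R : realType) (V : finType) (e : rel V)
    (E : execution R V) (l : nat) : \bar R :=
  ereal_sup [set x | exists k v w,
    [/\ e v w, ~ faulty E (v, l), ~ faulty E (w, l)
      & x = `|pulse E v l k - pulse E w l k|%:E]].

(* E' differs from E only in that some (possibly none) of the faulty nodes of E
   are correct: the remaining faulty nodes send the same messages, and later
   pulses are determined by the algorithm. *)
Definition some_faults_removed (R : realType) (V : finType)
    (E E' : execution R V) : Prop :=
  [/\ faulty E' `<=` faulty E, delay E' = delay E, clock E' = clock E,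
      message E' = message E
    & forall v k, ~ faulty E (v, 0%N) -> pulse E' v 0 k = pulse E v 0 k].

Definition parameter_bounds (R : realType) (V : finType) (e : rel V)
    (p : params R) (C0 : R) (E : execution R V) : Prop :=
  let Lsup := ereal_sup (range (layer_skew e E)) in
  let d := max_delay p in let u := uncertainty p in
  [/\ (C0 * theta p)%:E * (Lsup + u%:E) + d%:E <= (Lambda p)%:E,
      C0%:E * ((theta p)%:E * (Lsup + u%:E) + (kappa p)%:E) <= d%:E
    & (C0 * (u + (theta p - 1) * d) <= d)%R].

End Algorithm.

Definition log2 (R : realType) (x : R) : R := ln x / ln 2.

(* Main.v *)
(* Whether a node has fired by time [y] is a monotone condition on the reception
   times at that node ([fires_by]), and it commutes with time shifts because
   clocks run at a constant rate. So the algorithm is nonexpansive in the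
   sup-norm: if one faulty node is made correct and the execution is re-run,
   the pulses of all other nodes move by at most the change at the successors of
   that node. This change is at most [2 * A + 4 * kap], where [A] bounds the
   skew of the new execution, since the output of the algorithm is confined by
   the inputs from the correct predecessors, whatever the faulty one does.
   Hence each fault turns a skew bound [A] into [5 * A + 8 * kap].

   Without faults, let [tau l v] be the pulse time minus [l * Lambda], and let
   Psi(s) be the supremum over [l, v, w] of
   [tau l v - tau l w - 4 * s * kap * dist v w]. From any layer on, the upper
   envelope with slope [(4 * s + 2) * kap] around a node falls by [kap] per
   layer, while the lower envelope with slope [4 * (s + 1) * kap] falls by at
   most [kap / 2] per layer. So a late node catches up within [Psi(s) / kap]
   layers, and Psi(s + 1) is at most about half of Psi(s). Starting from the
   global bound Psi(0) = O(D * kap), the level [s] = log D + O(1) gives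
   Psi(s) = O(kap), that is, a local skew O(kap * log D). *)

Require Import Defs.
From mathcomp Require Import all_boot all_order all_algebra.
From mathcomp Require Import all_classical all_reals all_analysis.
From mathcomp Require Import lra ring zify.

Import Order.TTheory GRing.Theory Num.Theory.

Set Implicit Arguments.
Unset Strict Implicit.
Unset Printing Implicit Defensive.

Local Open Scope classical_set_scope.
Local Open Scope card_scope.

(** * Distances in the base graph *)

(** What the envelope arguments need of the graph distance: each vertex other than the centre has a
    neighbour one step nearer, and no neighbour is more than one step farther. *)
Record dist_like (V : finType) (e : rel V) (dist : V -> V -> nat) : Prop := {
  dist_self : forall w, dist w w = 0%N;
  dist_step : forall w x y, e x y -> (dist y w <= (dist x w).+1)%N;
  dist_closer : forall w x, x != w ->
    exists2 y, e x y & dist x w = (dist y w).+1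
}.

Section GraphDist.
Context {V : finType} (e : rel V).
Hypothesis sym_e : symmetric e.
Hypothesis con_e : forall x y, connect e x y.

Lemma walkP n x y :
  reflect (exists p, [/\ path e x p, last x p = y & size p = n]) (walk e n x y).
Proof.
apply: (iffP existsP) => [[p /andP[xp /eqP yp]]|[p [xp yp sp]]].
  by exists p; rewrite size_tuple.
have sp' : size p == n by apply/eqP.
by exists (Tuple sp') => /=; rewrite xp yp eqxx.
Qed.

Lemma graph_dist_le n x y : walk e n x y -> (graph_dist e x y <= n)%N.
Proof.
move=> w; rewrite /graph_dist.
have [nV|Vn] := ltnP n #|V|.
  have := mem_index_enum (Ordinal nV).
  elim: (index_enum _) => // i r IH; rewrite inE big_cons => /predU1P[<-|/IH {}IH].
    by rewrite w geq_minl.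
  by case: ifP => // _; rewrite geq_min IH orbT.
(* For [n >= #|V|] the default value of the minimum already gives the bound. *)
by apply: leq_trans Vn; elim/big_rec: _ => // i m _ mV; rewrite geq_min mV orbT.
Qed.

(** A path without repeated vertices has length below [#|V|], so the minimum is attained by a walk
    and is not the default value. *)
Lemma walk_graph_dist x y : walk e (graph_dist e x y) x y.
Proof.
have [p xp yp] := connectP (con_e x y).
case: (shortenP xp) yp => q xq uq _ yq.
have sq : (size q < #|V|)%N.
  by rewrite -[(size q).+1]/(size (x :: q)) -(card_uniqP uq) max_card.
have wq : walk e (size q) x y by apply/walkP; exists q.
rewrite /graph_dist.
have [//|E] : walk e (graph_dist e x y) x y \/ graph_dist e x y = #|V|.
  rewrite /graph_dist; elim/big_ind: _ => [|m n Hm Hn|i wi]; [by right| |by left].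
  by case: leqP.
by have := graph_dist_le wq; rewrite E leqNgt sq.
Qed.

Lemma walk_sym n x y : walk e n x y = walk e n y x.
Proof.
suff W a b : walk e n a b -> walk e n b a by apply/idP/idP; exact: W.
move=> /walkP[p [ap bp sp]]; apply/walkP; exists (rev (belast a p)); split.
- by rewrite -bp rev_path; rewrite (eq_path (e' := e)) // => u v; exact: sym_e.
- by case: p {ap sp} bp => [|c p] //= _; rewrite rev_cons last_rcons.
- by rewrite size_rev size_belast.
Qed.

Lemma graph_dist_sym x y : graph_dist e x y = graph_dist e y x.
Proof.
by apply/eqP; rewrite eqn_leq !graph_dist_le // walk_sym walk_graph_dist.
Qed.

Lemma graph_distP : dist_like e (graph_dist e).
Proof.
split.
- move=> w; apply/eqP; rewrite -leqn0; apply: graph_dist_le.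
  by apply/walkP; exists [::].
- move=> w x y exy; apply: graph_dist_le.
  have /walkP[p [xp wp sp]] := walk_graph_dist x w.
  by apply/walkP; exists (x :: p); rewrite /= sym_e exy sp.
- move=> w x nxw.
  have /walkP[[|y p] [/= xp wp sp]] := walk_graph_dist x w.
    by rewrite wp eqxx in nxw.
  have /andP[exy yp] := xp; exists y => //.
  apply/eqP; rewrite eqn_leq; apply/andP; split.
    apply: graph_dist_le; have /walkP[q [yq wq sq]] := walk_graph_dist y w.
    by apply/walkP; exists (y :: q); rewrite /= exy sq.
  by rewrite -sp ltnS; apply: graph_dist_le; apply/walkP; exists p.
Qed.

Lemma graph_dist_diameter x y : (graph_dist e x y <= diameter e)%N.
Proof.
rewrite /diameter.
apply: leq_trans (leq_bigmax_cond (F := fun x => \max_y graph_dist e x y) x isT).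
exact: (leq_bigmax_cond (F := fun y => graph_dist e x y) y isT).
Qed.

End GraphDist.

Local Open Scope ring_scope.

(** * The gradient argument without faults *)

(** Here [tau] and [tau'] are normalized pulse times of consecutive layers. [step_fast] and
    [step_slow] are the fast and slow conditions of gradient clock synchronization. By [step_wait] a
    node is delayed only if its new time stays [5 / 4 * kap] below the old times of all neighbours;
    [step_near_min] and [step_drop] limit how far it moves ahead. *)
Record gradient_step (R : realType) (V : finType) (e : rel V) (kap : R)
    (tau tau' : V -> R) : Prop := {
  step_wait : forall v y, e v y ->
    tau' v <= tau v \/ tau' v <= tau y - 5 / 4 * kap;
  step_fast : forall (s : nat) v y P, e v y -> tau v <= P ->
    (forall z, e v z -> tau z <= P + (4 * s%:R + 2) * kap) ->
    tau y <= P - (4 * s%:R + 2) * kap -> tau' v <= P - kap;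
  step_slow : forall (s : nat) v y Q, e v y -> Q <= tau v ->
    (forall z, e v z -> Q - 4 * s%:R * kap <= tau z) ->
    Q + 4 * s%:R * kap <= tau y -> Q - kap / 2 <= tau' v;
  step_near_min : forall v, exists2 y, e v y & tau y - 2 * kap <= tau' v;
  step_drop : forall v y, e v y ->
    tau y <= tau' v \/ tau v - 2 * kap <= tau' v
}.

Section FaultFree.
Context {R : realType} {V : finType} (e : rel V) (dist : V -> V -> nat) (D : nat).
Context (kap : R) (tau : nat -> V -> R).
Hypothesis sym_e : symmetric e.
Hypothesis deg_e : forall v, exists w, e v w.
Hypothesis distP : dist_like e dist.
Hypothesis dist_sym : forall x y, dist x y = dist y x.
Hypothesis dist_diam : forall x w, (dist x w <= D)%N.
Hypothesis kap_gt0 : 0 < kap.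
Hypothesis stepP : forall l, gradient_step e kap (tau l) (tau l.+1).
Hypothesis tau0P : forall v w, e v w -> tau 0%N v - tau 0%N w <= kap.

(* This keeps waiting from moving a pulse up by more than [kap] over any number
   of layers. *)
Lemma no_deep_local_min l v : exists2 y, e v y & tau l y <= tau l v + 2 * kap.
Proof.
have k0 := kap_gt0.
elim: l v => [|l IH] v.
  have [y evy] := deg_e v; exists y => //.
  by have := tau0P (etrans (sym_e y v) evy); lra.
have [y evy Hy] := step_near_min (stepP l) v; exists y => //.
have [z eyz Hz] := IH y.
have eyv : e y v by rewrite sym_e.
(* If [y] waits, its new time is [5 / 4 * kap] below the old times of [v] and [z], so it rises by at
   most [3 / 4 * kap]; [step_drop] then relates the old and new times around [v]. *)
have [H1|H1] := step_wait (stepP l) eyv; first by lra.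
have [H2|H2] := step_wait (stepP l) eyz; first by lra.
by have [H3|H3] := step_drop (stepP l) evy; lra.
Qed.

(** The vertex [w] and a neighbour at most [2 * kap] later block each other: either can wait only up
    to [5 / 4 * kap] below the other, so the bounds [kap] and [9 / 4 * kap] reproduce themselves. *)
Lemma bounded_rise l n w : tau (l + n) w <= tau l w + kap.
Proof.
have k0 := kap_gt0.
have [y ewy Hy] := no_deep_local_min l w.
suff: tau (l + n) w <= tau l w + kap /\ tau (l + n) y <= tau l w + 9 / 4 * kap.
  by case.
have eyw : e y w by rewrite sym_e.
elim: n => [|n [IH1 IH2]]; first by rewrite addn0; split; lra.
rewrite addnS.
by have [H1|H1] := step_wait (stepP (l + n)) ewy;
  have [H2|H2] := step_wait (stepP (l + n)) eyw; split; lra.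
Qed.

(** Away from [w] the neighbour nearer to [w] triggers the fast condition, with the envelope value
    as [P]. At [w] itself [bounded_rise] takes over, at the cost of the extra [kap]. *)
Lemma fast_envelope (s l : nat) w B :
  (forall x, tau l x <= tau l w + (4 * s%:R + 2) * kap * (dist x w)%:R + B) ->
  forall n x, tau (l + n) x <=
    tau l w + kap + (4 * s%:R + 2) * kap * (dist x w)%:R
    + Num.max 0 (B - kap * n%:R).
Proof.
have k0 := kap_gt0.
move=> H0; elim=> [|n IH] x.
  by rewrite addn0 mulr0 subr0; have := H0 x; case: (lerP 0 B) => ?; lra.
have [->|nxw] := eqVneq x w.
  rewrite (dist_self distP) mulr0 addr0.
  apply: (le_trans (bounded_rise l n.+1 w)).
  by rewrite lerDl le_max lexx.
set a := (4 * s%:R + 2) * kap in H0 IH *.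
have a0 : 0 <= a by rewrite mulr_ge0 ?addr_ge0 ?mulr_ge0 // ltW.
have [y exy dxy] := dist_closer distP nxw.
pose P := tau l w + kap + a * (dist x w)%:R + Num.max 0 (B - kap * n%:R).
have HP : tau (l + n).+1 x <= P - kap.
  apply: (step_fast (stepP _) (s := s) exy); rewrite -/a.
  - exact: IH.
  - move=> z exz; apply: (le_trans (IH z)).
    have : a * (dist z w)%:R <= a * (dist x w)%:R + a.
      rewrite -[X in _ + X]mulr1 -mulrDr ler_wpM2l // natr1 ler_nat.
      exact: dist_step distP _ _ _ exz.
    by rewrite /P; lra.
  - apply: (le_trans (IH y)).
    by rewrite /P dxy -natr1 mulrDr mulr1; lra.
rewrite addnS; apply: (le_trans HP); rewrite /P -natr1 mulrDr mulr1.
case: (lerP 0 (B - kap * n%:R)) => ?;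
  by case: (lerP 0 (B - (kap * n%:R + kap))) => ?; lra.
Qed.

(** The envelope is anchored at the last layer: since [v] rises by at most [kap] until then, it lies
    above [c] in all layers between. Elsewhere the neighbour nearer to [v] triggers the slow
    condition. *)
Lemma slow_envelope (s l n : nat) v c : c + kap <= tau (l + n) v ->
  (forall x, c - 4 * s%:R * kap * (dist x v)%:R <= tau l x) ->
  forall x, c - 4 * s%:R * kap * (dist x v)%:R - n%:R * kap / 2
    <= tau (l + n) x.
Proof.
move=> cv H0.
suff H m x : (m <= n)%N ->
    c - 4 * s%:R * kap * (dist x v)%:R - m%:R * kap / 2 <= tau (l + m) x.
  by move=> x; exact: H.
elim: m x => [|m IH] x lemn; first by rewrite addn0; have := H0 x; lra.
have [->|nxv] := eqVneq x v.
  rewrite (dist_self distP) mulr0 subr0.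
  have := bounded_rise (l + m.+1) (n - m.+1) v.
  rewrite -addnA subnKC //.
  have : 0 <= m.+1%:R * kap / 2 by rewrite divr_ge0 // mulr_ge0 // ltW.
  by lra.
set b := 4 * s%:R * kap in H0 IH *.
have b0 : 0 <= b by rewrite !mulr_ge0 // ltW.
have [y exy dxy] := dist_closer distP nxv.
have {}IH z : c - b * (dist z v)%:R - m%:R * kap / 2 <= tau (l + m) z.
  by apply: IH; rewrite ltnW.
rewrite addnS.
have : c - b * (dist x v)%:R - m%:R * kap / 2 - kap / 2 <= tau (l + m).+1 x.
  apply: (step_slow (stepP _) (s := s) exy); rewrite -/b.
  - exact: IH.
  - move=> z exz; apply: le_trans (IH z).
    have : b * (dist z v)%:R <= b * (dist x v)%:R + b.
      rewrite -[X in _ + X]mulr1 -mulrDr ler_wpM2l // natr1 ler_nat.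
      exact: dist_step distP _ _ _ exz.
    by lra.
  - apply: le_trans (IH y).
    by rewrite dxy -natr1 mulrDr mulr1; lra.
by rewrite -[m.+1%:R]natr1 mulrDl mul1r; lra.
Qed.

Lemma layer0_lipschitz v x : tau 0%N v - tau 0%N x <= kap * (dist v x)%:R.
Proof.
move E : (dist v x) => n; elim: n v E => [|n IH] v E.
  have [->|nvx] := eqVneq v x; first by rewrite subrr mulr0.
  by have [y _] := dist_closer distP nvx; rewrite E.
have [vx|nvx] := eqVneq v x; first by rewrite vx (dist_self distP) in E.
have [y evy] := dist_closer distP nvx; rewrite E => -[dyx].
have := IH y (esym dyx); have := tau0P evy.
by rewrite -natr1 mulrDr mulr1; lra.
Qed.

(** At level [0] the upper envelope has slope [2 * kap] and loses its excess [(4 * D + 2) * kap] in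
    [4 * D + 2] layers, while the flat lower envelope falls by [(2 * D + 1) * kap]. So the bound
    reproduces itself. *)
Lemma global_skew l v w : tau l v - tau l w <= (4 * D%:R + 2) * kap.
Proof.
have D0 : 0 <= D%:R * kap by rewrite mulr_ge0 // ltW.
have dD x y : kap * (dist x y)%:R <= D%:R * kap.
  by rewrite mulrC ler_wpM2r ?ler_nat // ltW.
have TE : (4 * D + 2)%:R = 4 * D%:R + 2 :> R by rewrite natrD natrM.
have drop m n v' w' : (n <= 4 * D + 2)%N ->
    (forall x, tau (m + n) v' - kap - 2 * (D%:R * kap) <= tau m x) ->
    tau (m + n) v' - tau (m + n) w' <= (4 * D%:R + 2) * kap.
  move=> nT H.
  have : n%:R * kap <= (4 * D%:R + 2) * kap.
    by rewrite ler_wpM2r ?(ltW kap_gt0) // -TE ler_nat.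
  have := @slow_envelope 0%N m n v' (tau (m + n) v' - kap - 2 * (D%:R * kap)).
  rewrite mulr0 mul0r => K.
  have : tau (m + n) v' - kap - 2 * (D%:R * kap) - 0 * (dist w' v')%:R
      - n%:R * kap / 2 <= tau (m + n) w'.
    by apply: K => [|x]; [lra | rewrite mul0r subr0].
  by rewrite mul0r; lra.
elim/ltn_ind: l v w => l IH v w.
(* With fewer layers below, the Lipschitz bound of layer [0] replaces the upper envelope. *)
have [lT|Tl] := ltnP l (4 * D + 2).
  rewrite -[l]add0n; apply: drop (ltnW lT) _ => x.
  have := bounded_rise 0%N l v; have := layer0_lipschitz v x.
  by have := dD v x; lra.
rewrite -(subnK Tl); apply: drop => // x.
set m := (l - _)%N.
have mT : (m < l)%N by rewrite /m ltn_subrL addn2 (leq_trans _ Tl) // addn2.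
have H y : tau m y <= tau m x + (4 * 0%:R + 2) * kap * (dist y x)%:R
    + (4 * D%:R + 2) * kap.
  have := IH m mT y x.
  have : 0 <= (4 * 0%:R + 2) * kap * (dist y x)%:R :> R.
    by rewrite !mulr_ge0 // ?ltW // mulr0 add0r.
  by lra.
have := fast_envelope (s := 0%N) H (4 * D + 2) v.
by rewrite TE mulr0 add0r [kap * _]mulrC subrr maxxx; have := dD v x; lra.
Qed.

(** Within [T] layers the upper envelope of level [s] loses its excess [B * kap], so a late [v]
    forces layer [l - T] above the lower envelope of level [s.+1], which then falls by at most
    [T * kap / 2]. *)
Lemma local_skew_step (s : nat) (B : R) (T : nat) : 0 <= B -> B <= T%:R ->
  (forall l v w, tau l v - tau l w <= (B + 4 * s%:R * (dist v w)%:R) * kap) ->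
  forall l v w, tau l v - tau l w <=
    (T%:R / 2 + 1 + 4 * s.+1%:R * (dist v w)%:R) * kap.
Proof.
move=> B0 BT H l v w.
have k0 := ltW kap_gt0.
have drop m n : (n <= T)%N ->
    (forall x, tau (m + n) v - kap - 4 * s.+1%:R * kap * (dist x v)%:R
      <= tau m x) ->
    tau (m + n) v - tau (m + n) w <=
      (T%:R / 2 + 1 + 4 * s.+1%:R * (dist v w)%:R) * kap.
  move=> nT H0.
  have : n%:R * kap <= T%:R * kap by rewrite ler_wpM2r // ler_nat.
  have := @slow_envelope s.+1 m n v (tau (m + n) v - kap).
  rewrite subrK lexx => /(_ isT H0 w).
  by rewrite [dist w v]dist_sym; lra.
have [lT|Tl] := ltnP l T.
  rewrite -[l]add0n; apply: drop (ltnW lT) _ => x.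
  have := bounded_rise 0%N l v; have := layer0_lipschitz v x.
  have : kap * (dist v x)%:R <= 4 * s.+1%:R * kap * (dist x v)%:R.
    rewrite dist_sym ler_wpM2r // -[X in X <= _]mul1r ler_wpM2r //.
    have : 1 <= s.+1%:R :> R by rewrite ler1n.
    by lra.
  by lra.
rewrite -(subnK Tl); apply: drop => // x.
set m := (l - T)%N.
have Hm y : tau m y <= tau m x + (4 * s%:R + 2) * kap * (dist y x)%:R + B * kap.
  have := H m y x.
  have : 0 <= kap * (dist y x)%:R by rewrite mulr_ge0.
  by lra.
have := fast_envelope (s := s) Hm T v.
rewrite max_l; last by have : B * kap <= T%:R * kap; [rewrite ler_wpM2r | lra].
have : 0 <= kap * (dist v x)%:R by rewrite mulr_ge0.
by rewrite -[s.+1%:R]natr1 [dist x v]dist_sym; lra.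
Qed.

(** Since [T <= B + 1], one level maps [B] to at most [(B + 1) / 2 + 1]. The fixed point is [3], and
    the deviation from it halves. *)
Lemma local_skew (s : nat) l v w : tau l v - tau l w <=
  (3 + (4 * D%:R + 2) / 2 ^+ s + 4 * s%:R * (dist v w)%:R) * kap.
Proof.
have D0 : 0 <= 4 * D%:R + 2 :> R by rewrite addr_ge0 // mulr_ge0.
elim: s l v w => [|s IH] l v w.
  rewrite expr0 divr1 mulr0 mul0r addr0; have := global_skew l v w.
  by have := kap_gt0; lra.
set B := 3 + _ in IH.
have B0 : 0 <= B by rewrite addr_ge0 // divr_ge0 // exprn_ge0.
pose T := (Num.truncn B).+1.
have BT : B <= T%:R by rewrite ltW // truncnS_gt.
have TB : T%:R <= B + 1 by rewrite /T -natr1 lerD2r truncn_le.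
apply: (le_trans (local_skew_step B0 BT IH l v w)).
rewrite ler_wpM2r ?(ltW kap_gt0) // lerD2r.
rewrite exprS invfM mulrCA -/B.
move: TB; rewrite /B; set q := _ / _.
by lra.
Qed.

Lemma neighbour_skew (s : nat) l v w : (4 * D + 2 <= 2 ^ s)%N -> e v w ->
  tau l v - tau l w <= 4 * (s%:R + 1) * kap.
Proof.
move=> Ds evw; apply: (le_trans (local_skew s l v w)).
rewrite ler_wpM2r ?(ltW kap_gt0) //.
have dvw : (dist v w)%:R <= 1 :> R.
  have ewv : e w v by rewrite sym_e.
  by rewrite lern1; have := dist_step distP w ewv; rewrite (dist_self distP).
have : (4 * D%:R + 2) / 2 ^+ s <= 1 :> R.
  rewrite ler_pdivrMr ?exprn_gt0 // mul1r -natrX.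
  by rewrite -[2]/(2%:R) -[4]/(4%:R) -natrM -natrD ler_nat.
have : s%:R * (dist v w)%:R <= s%:R * 1 :> R by rewrite ler_wpM2l.
by lra.
Qed.

End FaultFree.

(** * The algorithm as a monotone condition on reception times *)

(** The correction formula as a min-max condition, where [y] bounds the pulse time less
    [Lambda - d]: [y] is at least [H_min - 3 * kap / 2], and either at least [H_max + 3 * kap / 2]
    or at least [H_own - th * kap] and one of [H_own], [H_own - Delta]. Infinite inputs need no
    separate case. *)
Definition fires_by (R : realType) (V : finType) (e : rel V) (th kap : R)
    (v : V) (h : V -> \bar R) (y : R) : Prop :=
  (exists2 w, e v w & (h w <= (y + 3 * kap / 2)%:E)%E) /\
  ((forall w, e v w -> (h w <= (y - 3 * kap / 2)%:E)%E) \/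
   (h v <= (y + th * kap)%:E)%E /\
   ((h v <= y%:E)%E \/
    forall s : nat,
      (forall w, e v w -> (h w <= (y - kap / 2 + 4 * s%:R * kap)%:E)%E) \/
      (exists2 w, e v w & (h w <= (y - kap / 2 - 4 * s%:R * kap)%:E)%E))).

Section LocalTime.
Context {R : realType} (p : params R).
Hypothesis kap_gt0 : 0 < kappa p.

Hypothesis theta_ge0 : 0 <= theta p.

Let ks_ge0 (s : nat) : 0 <= 4 * s%:R * kappa p.
Proof. exact: mulr_ge0 (mulr_ge0 (ler0n _ 4) (ler0n _ s)) (ltW kap_gt0). Qed.

(** The left terms bound the infimum below by [own - mx], the term at [0] bounds it above.
    Describing [Del] by its lower bounds avoids locating a minimizing [s]. *)
Lemma discrepancy_fin (own mn mx : R) :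
  exists2 Del : R,
    discrepancy (kappa p) own%:E mn%:E mx%:E = Del%:E &
    forall z, z <= Del <-> forall s : nat,
      z + kappa p / 2 <= Num.max (own - mx + 4 * s%:R * kappa p)
                                 (own - mn - 4 * s%:R * kappa p).
Proof.
have k0 := kap_gt0; have ks := ks_ge0.
pose a (s : nat) : R := Num.max (own - mx + 4 * s%:R * kappa p)
                                 (own - mn - 4 * s%:R * kappa p).
have aE : (fun s : nat => maxe (own%:E - mx%:E + (4 * s%:R * kappa p)%:E)
    (own%:E - mn%:E - (4 * s%:R * kappa p)%:E))%E = (fun s => (a s)%:E).
  by apply/funext => s; rewrite -!EFinB -EFinD -EFin_max.
rewrite /discrepancy /= aE.
set I := ereal_inf _.
have Ia s : (I <= (a s)%:E)%E by apply: ereal_inf_lbound; exists s.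
have aI z : (forall s, (z <= (a s)%:E)%E) -> (z <= I)%E.
  by move=> H; apply: le_ereal_inf_tmp => _ [s _ <-].
have : I \is a fin_num.
  rewrite fin_numE; apply/andP; split.
    have : ((own - mx)%:E <= I)%E.
      apply: aI => s; rewrite lee_fin /a le_max; apply/orP; left.
      by rewrite lerDl ks.
    by apply: contraTneq => ->; rewrite leeNy_eq.
  by have := Ia 0%N; apply: contraTneq => ->; rewrite leye_eq.
move=> /fineK IE; exists (fine I - kappa p / 2); first by rewrite -IE.
move=> z; rewrite lerBrDr -lee_fin IE; split=> [H s|H].
  by rewrite -lee_fin; exact: le_trans (Ia s).
by apply: aI => s; rewrite lee_fin; exact: H.
Qed.

Lemma pulse_local_time_leP (own hmax : \bar R) (mn y : R) :
  (-oo < own)%E -> (mn%:E <= hmax)%E ->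
  (pulse_local_time p own mn%:E hmax <= (y + (Lambda p - max_delay p))%:E)%E <->
  mn <= y + 3 * kappa p / 2 /\
  ((hmax <= (y - 3 * kappa p / 2)%:E)%E \/
   (own <= (y + theta p * kappa p)%:E)%E /\
   ((own <= y%:E)%E \/
    forall s : nat, (hmax <= (y - kappa p / 2 + 4 * s%:R * kappa p)%:E)%E \/
      mn <= y - kappa p / 2 - 4 * s%:R * kappa p)).
Proof.
have k0 := kap_gt0; have ks := ks_ge0.
move=> own_gt mn_le; have tk0 := mulr_ge0 theta_ge0 (ltW kap_gt0).
rewrite /pulse_local_time.
case: own own_gt => [own _|_|//]; last first.
  rewrite eqxx; case: hmax mn_le => [mx|_|] //.
    rewrite -EFinD !lee_fin => mn_le; split=> [H|[_ [H|[//]]]]; last by lra.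
    by split; [|left]; lra.
  by split=> [|[_ [|[]]]].
rewrite (_ : (own%:E == +oo%E) = false) //.
case: hmax mn_le => [mx|_|//]; last first.
  rewrite /correction /discrepancy eqxx ltNy0 -EFinB -EFinD -EFin_min.
  rewrite -!EFinD lee_fin !leye_eq /= !lee_fin.
  split=> [|[H1 [//|[H2 [H3|H3]]]]].
  - case: (lerP (own - mn + 3 * kappa p / 2) 0) => c H; split; try lra;
      by right; split; [lra|left; lra].
  - by case: (lerP (own - mn + 3 * kappa p / 2) 0) => c; lra.
  (* With [hmax = +oo] the clause fails at any [s] with [4 * s * kap] above [y - kap / 2 - mn]. *)
  - have [s Hs] : exists s : nat, (y - kappa p / 2 - mn) / (4 * kappa p) < s%:R.
      by eexists; exact: truncnS_gt.
    have [//|] := H3 s.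
    by move: Hs; rewrite ltr_pdivrMr; lra.
rewrite !lee_fin => mn_le; rewrite /correction.
have [Del -> DelP] := discrepancy_fin own mn mx.
(* These two bounds place [own - Del] between [mn + kap / 2] and [mx + kap / 2], which reconciles
   the three branches of the correction with the clauses. *)
have Del_mn : Del <= own - mn - kappa p / 2.
  have /DelP/(_ 0%N) : Del <= Del by [].
  by rewrite mulr0 mul0r addr0 subr0; case: (lerP (own - mx)); lra.
have Del_mx : own - mx - kappa p / 2 <= Del.
  apply/DelP => s; rewrite le_max; apply/orP; left.
  by have := ks s; lra.
have -> : (forall s : nat, (mx%:E <= (y - kappa p / 2 + 4 * s%:R * kappa p)%:E)%E
    \/ mn <= y - kappa p / 2 - 4 * s%:R * kappa p) <-> own - Del <= y.
  rewrite lerBlDl -lerBlDr; split=> [H|/DelP H s].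
    apply/DelP => s; rewrite le_max; apply/orP.
    by have [] := H s; rewrite ?lee_fin => ?; [left|right]; lra.
  by have := H s; rewrite le_max => /orP[] ?; [left|right]; rewrite ?lee_fin; lra.
rewrite !lee_fin lte_fin.
have [D0|D0] := ltrP Del 0.
  rewrite -EFinB -EFinD -EFin_min -EFinD lee_fin.
  by case: (lerP (own - mn + 3 * kappa p / 2) 0) => C0; split=> H; lra.
have [D1|D1] := lerP Del (theta p * kappa p).
  by rewrite -!EFinD lee_fin; split=> H; lra.
rewrite -!EFinB -EFin_max -!EFinD lee_fin.
by case: (lerP (own - mx - 3 * kappa p / 2)) => C0; split=> H; lra.
Qed.

Lemma pulse_local_time_fires (V : finType) (e : rel V) (v : V)
    (h : V -> \bar R) (y : R) :
  (forall w, (-oo < h w)%E) -> (exists2 w, e v w & (h w < +oo)%E) ->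
  (pulse_local_time p (h v) (\big[mine/+oo%E]_(w | e v w) h w)
     (\big[maxe/-oo%E]_(w | e v w) h w)
     <= (y + (Lambda p - max_delay p))%:E)%E <->
  fires_by e (theta p) (kappa p) v h y.
Proof.
move=> h_gt [w0 ew0 hw0].
have minP z : (\big[mine/+oo%E]_(w | e v w) h w <= z%:E)%E <->
    exists2 w, e v w & (h w <= z%:E)%E.
  by split=> [/bigmin_leP[|//]|H]; [rewrite leye_eq | apply/bigmin_leP; right].
have maxP z : (\big[maxe/-oo%E]_(w | e v w) h w <= z%:E)%E <->
    forall w, e v w -> (h w <= z%:E)%E.
  by split=> [/bigmax_leP[]//|H]; apply/bigmax_leP; rewrite leNye.
have [mn mnE] : exists mn, (\big[mine/+oo%E]_(w | e v w) h w) = mn%:E.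
  exists (fine (\big[mine/+oo%E]_(w | e v w) h w)); rewrite fineK //.
  rewrite fin_numElt; apply/andP; split.
    by apply/bigmin_gtP; split=> // w _; exact: h_gt.
  by apply/bigmin_ltP; right; exists w0.
rewrite mnE pulse_local_time_leP ?h_gt //; last first.
  rewrite -mnE; apply: (@le_trans _ _ (h w0)).
    by apply/bigmin_leP; right; exists w0.
  exact: le_bigmax_cond.
rewrite /fires_by; rewrite mnE in minP.
split=> [[/minP H1 H2]|[/minP H1 H2]]; split => //.
- case: H2 => [/maxP|[H2 H3]]; [by left | right; split => //].
  case: H3 => [|H3]; [by left | right => s].
  by case: (H3 s) => [/maxP|/minP]; [left|right].
- case: H2 => [/maxP|[H2 H3]]; [by left | right; split => //].
  case: H3 => [|H3]; [by left | right => s].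
  by case: (H3 s) => [/maxP|/minP]; [left|right].
Qed.

End LocalTime.

(* In the real time of a receiver with clock rate [rho] the algorithm runs with
   [lam = kap / rho] in place of [kap]; the error [4 * s * (kap - lam)] this
   causes matters only for levels [s] below the local skew, where [q * lr]
   controls it. *)
Lemma gradient_step_fires_by (R : realType) (V : finType) (e : rel V)
    (th kap q lr : R) (tau tau' : V -> R) (lam : V -> R) (sig : V -> V -> R) :
  0 < kap -> 0 <= q <= 1 / 16 -> th * (1 - q) = 1 -> q * lr <= kap / 32 ->
  (forall v w, e v w -> `|tau v - tau w| <= lr) ->
  (forall v, exists w, e v w) ->
  (forall v, kap * (1 - q) <= lam v <= kap) ->
  (forall v w, pred_of e v w -> tau w - kap / 2 <= sig v w <= tau w) ->
  (forall v y, tau' v <= y <-> fires_by e th (lam v) v (EFin \o sig v) y) ->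
  gradient_step e kap tau tau'.
Proof.
move=> k0 /andP[q0 q1] thq qlr lrP deg lamP sigP firesP.
have kq0 : 0 <= kap * q by rewrite mulr_ge0 // ltW.
have kq : kap * q <= kap / 16 by have := ler_wpM2l (ltW k0) q1; lra.
have th1 : 1 <= th.
  have q1' : 0 < 1 - q by lra.
  by rewrite -(ler_pM2r q1') thq; lra.
have thlam v : kap <= th * lam v.
  have /andP[H _] := lamP v.
  have := ler_wpM2l (le_trans ler01 th1) H.
  by rewrite mulrCA thq mulr1.
have thlam2 v : th * lam v <= 17 / 15 * kap.
  have /andP[H0 H] := lamP v.
  have := ler_wpM2l (le_trans ler01 th1) H.
  have : 0 <= (th * kap) * (1 / 16 - q).
    by rewrite !mulr_ge0 ?subr_ge0 // ?ltW //; lra.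
  have : th * kap - th * kap * q = kap by rewrite -[RHS]mul1r -thq; ring.
  by lra.
have lamB v : 15 / 16 * kap <= lam v <= kap.
  by have /andP[H1 H2] := lamP v; apply/andP; split; lra.
have selfP v : pred_of e v v by rewrite /pred_of eqxx.
have nbrP v w : e v w -> pred_of e v w by rewrite /pred_of => ->; rewrite orbT.
split.
- move=> v y evy.
  have /andP[l1 l2] := lamB v; have thl := thlam v.
  have /andP[_ sv] := sigP _ _ (selfP v);
    have /andP[_ sy] := sigP _ _ (nbrP _ _ evy).
  have [H|H] := lerP (tau' v) (tau v); [by left|right].
  suff : tau' v <= Num.max (tau v) (tau y - 5 / 4 * kap).
    by rewrite le_max => /orP[|//]; lra.
  apply/firesP; split; last first.
    right => /=; rewrite !lee_fin; split; last left;
    by case: (lerP (tau v)); lra.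
  exists y => //=; rewrite lee_fin.
  by case: (lerP (tau v)); lra.
- move=> s v y P evy vP nP yP; apply/firesP.
  have /andP[l1 l2] := lamB v; have thl := thlam v; have /andP[lq _] := lamP v.
  have /andP[_ sv] := sigP _ _ (selfP v);
    have /andP[_ sy] := sigP _ _ (nbrP _ _ evy).
  have s0 : 0 <= s%:R * kap by rewrite mulr_ge0 // ltW.
  have lam0 : 0 <= lam v by lra.
  split; first by exists y => //=; rewrite lee_fin; lra.
  right => /=; rewrite !lee_fin; split; first by lra.
  (* Levels up to [s] are met by the early neighbour [y], higher levels by the bound on all
     neighbours. *)
  right => s'; have [ss'|s's] := ltnP s s'; last first.
    right; exists y => //=; rewrite lee_fin.
    have : s'%:R * lam v <= s%:R * kap by rewrite ler_pM // ler_nat.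
    by lra.
  left => w evw; rewrite lee_fin.
  have /andP[_ sw] := sigP _ _ (nbrP _ _ evw).
  have := lrP _ _ evw; rewrite ler_norml => /andP[lr1 _].
  have := nP _ evw => nw.
  have : s.+1%:R * (kap * (1 - q)) <= s'%:R * lam v.
    by apply: ler_pM; rewrite ?ler_nat ?mulr_ge0 // ?ltW //; lra.
  rewrite -natr1.
  (* At low levels the error [4 * (s + 1) * kap * q] is at most [q * (lr + 2 * kap)]; at high levels
     the skew bound [lr] alone suffices. *)
  have [lr2|lr2] := lerP (4 * (s%:R + 1) * kap) (lr + 2 * kap).
    by have := ler_wpM2r q0 lr2; lra.
  have q1' : 0 <= 1 - q by lra.
  by have := ler_wpM2r q1' (ltW lr2); lra.
- move=> s v y Q evy Qv nQ yQ.
  have /andP[l1 l2] := lamB v; have thl := thlam v; have /andP[lq _] := lamP v.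
  have /andP[sv _] := sigP _ _ (selfP v);
    have /andP[sy _] := sigP _ _ (nbrP _ _ evy).
  have s0 : 0 <= s%:R * kap by rewrite mulr_ge0 // ltW.
  have sl : s%:R * lam v <= s%:R * kap by rewrite ler_wpM2l.
  have /firesP[_ [H|/= [_ [H|/(_ s) [H|[w evw]]]]]] := lexx (tau' v).
  + by have := H _ evy; rewrite lee_fin; lra.
  + by move: H; rewrite lee_fin; lra.
  + by have := H _ evy; rewrite lee_fin; lra.
  + rewrite lee_fin => H.
    have /andP[sw _] := sigP _ _ (nbrP _ _ evw).
    have := lrP _ _ evw; rewrite ler_norml => /andP[_ lr1].
    have nw := nQ _ evw.
    have : s%:R * (kap * (1 - q)) <= s%:R * lam v by rewrite ler_wpM2l.
    have [lr2|lr2] := lerP (4 * s%:R * kap) lr.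
      by have := ler_wpM2r q0 lr2; lra.
    have q1' : 0 <= 1 - q by lra.
    by have := ler_wpM2r q1' (ltW lr2); lra.
- move=> v; have /firesP[[y evy /=]] := lexx (tau' v); rewrite lee_fin => H _.
  exists y => //; have /andP[sy _] := sigP _ _ (nbrP _ _ evy).
  by have /andP[l1 l2] := lamB v; lra.
- move=> v y evy; have /andP[l1 l2] := lamB v; have thl := thlam2 v.
  have /andP[sv _] := sigP _ _ (selfP v);
    have /andP[sy _] := sigP _ _ (nbrP _ _ evy).
  have /firesP[_ [/(_ y evy)|[]]] /= := lexx (tau' v); rewrite lee_fin => H.
    by left; lra.
  by move=> _; right; lra.
Qed.

(** * Monotonicity and range of the firing condition *)

Section FiresBy.
Context {R : realType} {V : finType} (e : rel V).
Implicit Types (th kap : R) (v : V) (h : V -> \bar R).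

(** Every clause compares an input with [y] plus a multiple of [kap], so it suffices to transport
    these thresholds. A translation [f] gives nonexpansiveness, an affine [f] the change between
    clock readings and real time. *)
Lemma fires_by_mono th kap1 kap2 v (h1 h2 : V -> \bar R) (f : R -> R) (y : R) :
  (forall c w, pred_of e v w ->
    (h1 w <= (y + c * kap1)%:E)%E -> (h2 w <= (f y + c * kap2)%:E)%E) ->
  fires_by e th kap1 v h1 y -> fires_by e th kap2 v h2 (f y).
Proof.
move=> H.
have nbrP w : e v w -> pred_of e v w by rewrite /pred_of => ->; rewrite orbT.
have H' c1 c2 c w : c1 = y + c * kap1 -> c2 = f y + c * kap2 -> pred_of e v w ->
    (h1 w <= c1%:E)%E -> (h2 w <= c2%:E)%E by move=> -> ->; exact: H.
have vv : pred_of e v v by rewrite /pred_of eqxx.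
move=> [[w evw Hw] H2]; split.
  by exists w => //; apply: (H' _ _ (3 / 2) w _ _ (nbrP _ evw) Hw); ring.
case: H2 => [H2|[H2 H3]]; [left => z evz|right; split].
- by apply: (H' _ _ (- (3 / 2)) z _ _ (nbrP _ evz) (H2 z evz)); ring.
- by apply: (H' _ _ th v _ _ vv H2); ring.
case: H3 => [H3|H3]; [left|right => s].
  by apply: (H' _ _ 0 v _ _ vv H3); ring.
case: (H3 s) => [H4|[z evz H4]]; [left => z evz|right; exists z => //].
  by apply: (H' _ _ (4 * s%:R - 1 / 2) z _ _ (nbrP _ evz) (H4 z evz)); field.
by apply: (H' _ _ (- 4 * s%:R - 1 / 2) z _ _ (nbrP _ evz) H4); field.
Qed.

Hypothesis irr_e : irreflexive e.

(** Here [w0] is the one predecessor that may be faulty. If it is [v] itself, all neighbours are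
    reliable and the clause on the maximum holds; otherwise the own reception time is reliable. *)
Lemma fires_by_range_le th kap v w0 h (b : R) : 0 <= kap -> 0 <= th ->
  (exists2 w, e v w & w != w0) ->
  (forall w, pred_of e v w -> w != w0 -> (h w <= b%:E)%E) ->
  fires_by e th kap v h (b + 3 / 2 * kap).
Proof.
move=> k0 th0 [w evw nw] H.
have tk0 : 0 <= th * kap by rewrite mulr_ge0.
have nbrP z : e v z -> pred_of e v z by rewrite /pred_of => ->; rewrite orbT.
have le c z : b <= c -> pred_of e v z -> z != w0 -> (h z <= c%:E)%E.
  by move=> bc vz nz; apply: le_trans (H _ vz nz) _; rewrite lee_fin.
split; first by exists w => //; apply: le (nbrP _ evw) nw; lra.
have [E|nv] := eqVneq v w0.
  left => z evz; apply: le (nbrP _ evz) _; first by lra.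
  by apply: contraTneq evz => ->; rewrite -E irr_e.
by right; split; [|left]; apply: le nv; rewrite /pred_of ?eqxx //; lra.
Qed.

Lemma fires_by_range_ge th kap v w0 h (a y : R) : 0 <= kap -> th <= 2 ->
  (exists2 w, e v w & w != w0) ->
  (forall w, pred_of e v w -> w != w0 -> (a%:E <= h w)%E) ->
  fires_by e th kap v h y -> a - 2 * kap <= y.
Proof.
move=> k0 th2 [w evw nw] H [[z evz Hz] H2].
have tk : th * kap <= 2 * kap by rewrite ler_wpM2r.
have nbrP u : e v u -> pred_of e v u by rewrite /pred_of => ->; rewrite orbT.
have ge c u : pred_of e v u -> u != w0 -> (h u <= c%:E)%E -> a <= c.
  by move=> vu nu hu; rewrite -lee_fin; apply: le_trans (H _ vu nu) hu.
case: H2 => [/(_ w evw)|[Hv _]].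
  by move=> /(ge _ _ (nbrP _ evw) nw); lra.
(* If the own time is unreliable, the clause on the minimum has a reliable witness [z]. *)
have [E|nv] := eqVneq v w0.
  have nz : z != w0 by apply: contraTneq evz => ->; rewrite -E irr_e.
  by have := ge _ _ (nbrP _ evz) nz Hz; lra.
have vv : pred_of e v v by rewrite /pred_of eqxx.
by have := ge _ _ vv nv Hv; lra.
Qed.

End FiresBy.

(** * From clock readings to real time *)

Lemma hardware_clock_affine (R : realType) (th : R) (H : R -> R) :
  hardware_clock th H ->
  exists2 rho, 1 <= rho <= th & forall t : R, 0 <= t -> H t = H 0 + rho * t.
Proof.
move=> [_ Hb [rho Hr]]; exists rho; last first.
  by move=> t t0; rewrite -[t in rho * t]subr0 -Hr // addrC subrK.
have := Hb 0 1 (lexx 0) ltr01; rewrite Hr // subr0 mulr1 mulr1.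
by move=> [-> ->].
Qed.

Definition pulse_target (R : realType) (V : finType) (e : rel V) (p : params R)
    (E : execution R V) (v : V) (l k : nat) : \bar R :=
  let h := local_reception E v l k in
  pulse_local_time p (h v) (\big[mine/+oo%E]_(w | e v w) h w)
                           (\big[maxe/-oo%E]_(w | e v w) h w).

Section OneNode.
Context {R : realType} {V : finType} (e : rel V) (p : params R).
Context (E : execution R V) (v : V) (l k : nat) (rho : R) (w0 : V).
Hypothesis irr_e : irreflexive e.
Hypothesis kap_gt0 : 0 < kappa p.
Hypothesis th_ge0 : 0 <= theta p.
Hypothesis rho_gt0 : 0 < rho.
Hypothesis clockE : forall t, 0 <= t ->
  clock E v l.+1 t = clock E v l.+1 0 + rho * t.
Hypothesis rec_ge0 : forall w, pred_of e v w -> (0 <= reception E v l k w)%E.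
Hypothesis nbr_w0 : exists2 w, e v w & w != w0.
Hypothesis rec_fin : forall w, pred_of e v w -> w != w0 ->
  (reception E v l k w < +oo)%E.

Lemma local_reception_le w (z : R) : pred_of e v w ->
  (local_reception E v l k w <= (clock E v l.+1 0 + rho * z)%:E)%E =
  (reception E v l k w <= z%:E)%E.
Proof.
move=> /rec_ge0; rewrite /local_reception.
case: (reception _ _ _ _ _) => [r r0|//|//].
by rewrite clockE // !lee_fin lerD2l ler_pM2l.
Qed.

(** A clock of rate [rho] stretches real time by [rho], so in real time the algorithm runs with
    [kappa p / rho]. *)
Lemma pulse_target_le (y : R) :
  (pulse_target e p E v l k <=
    (clock E v l.+1 0 + rho * y + (Lambda p - max_delay p))%:E)%E <->
  fires_by e (theta p) (kappa p / rho) v (reception E v l k) y.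
Proof.
rewrite /pulse_target pulse_local_time_fires //; last 2 first.
- move=> w; rewrite /local_reception.
  by case: (reception _ _ _ _ _) => *; rewrite ?ltNyr.
- have [w evw nw] := nbr_w0; exists w => //.
  have vw : pred_of e v w by rewrite /pred_of evw orbT.
  move: (rec_ge0 vw) (rec_fin vw nw).
  by rewrite /local_reception; case: (reception _ _ _ _ _) => *; rewrite ?ltry.
have r0 : rho != 0 by rewrite gt_eqF.
split; last first.
  apply: (fires_by_mono (f := fun y => clock E v l.+1 0 + rho * y)) => c w vw.
  rewrite -(local_reception_le _ vw); congr (_ <= _%:E)%E.
  by field.
pose z := clock E v l.+1 0 + rho * y; rewrite -/z.
have -> : y = (fun z => (z - clock E v l.+1 0) / rho) z by rewrite /z /=; field.
apply: (fires_by_mono (f := fun z => (z - clock E v l.+1 0) / rho)) => c w vw.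
rewrite -(local_reception_le _ vw) /z; congr (_ <= _%:E)%E.
by field.
Qed.

Lemma pulse_le (y : R) : 0 <= pulse E v l.+1 k ->
  follows_algorithm e p E v l k ->
  pulse E v l.+1 k <= y + (Lambda p - max_delay p) / rho <->
  fires_by e (theta p) (kappa p / rho) v (reception E v l k) y.
Proof.
move=> t0 F; have r0 : rho != 0 by rewrite gt_eqF.
rewrite -pulse_target_le.
have -> : pulse_target e p E v l k = (clock E v l.+1 (pulse E v l.+1 k))%:E by [].
rewrite clockE // lee_fin -addrA lerD2l.
rewrite -(ler_pM2l rho_gt0) mulrDr mulrCA mulfV // mulr1.
by split.
Qed.

(** Makes a re-run well defined. The target is finite because the reliable inputs are; it is not
    before the start of the clock because no input is negative and the wait covers
    [3 / 2 * kappa p]. *)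
Lemma pulse_target_clock : 3 / 2 * kappa p <= Lambda p - max_delay p ->
  exists2 t, 0 <= t & pulse_target e p E v l k = (clock E v l.+1 t)%:E.
Proof.
move=> Lam; have r0 : rho != 0 by rewrite gt_eqF.
set T := pulse_target _ _ _ _ _ _.
pose b := \big[Num.max/0]_w fine (reception E v l k w).
have T_lt : (T < +oo)%E.
  have /pulse_target_le : fires_by e (theta p) (kappa p / rho) v
      (reception E v l k) (b + 3 / 2 * (kappa p / rho)).
    apply: fires_by_range_le nbr_w0 _ => //; first by rewrite divr_ge0 // ltW.
    move=> w vw nw; rewrite -[leLHS]fineK; last first.
      by rewrite ge0_fin_numE ?rec_ge0 // rec_fin.
    by rewrite lee_fin /b; apply: (@le_bigmax_cond _ _ _ _ _ xpredT).
  by move/le_lt_trans; apply; rewrite ltry.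
have lower z : (T <= z%:E)%E -> clock E v l.+1 0 <= z.
  pose y := (z - clock E v l.+1 0 - (Lambda p - max_delay p)) / rho.
  have -> : z = clock E v l.+1 0 + rho * y + (Lambda p - max_delay p).
    by rewrite /y; field.
  move=> /pulse_target_le[[w evw Hw] _].
  have vw : pred_of e v w by rewrite /pred_of evw orbT.
  have := le_trans (rec_ge0 vw) Hw; rewrite lee_fin.
  rewrite -(pmulr_rge0 _ rho_gt0).
  rewrite (_ : rho * (_ + _) = rho * y + 3 / 2 * kappa p); last by field.
  by lra.
have T_fin : T \is a fin_num.
  rewrite fin_numElt T_lt andbT ltNye; apply/eqP => TE.
  have := lower (clock E v l.+1 0 - 1); rewrite TE leNye => /(_ isT).
  by lra.
have t0 : 0 <= (fine T - clock E v l.+1 0) / rho.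
  by rewrite divr_ge0 ?subr_ge0 ?(ltW rho_gt0) // lower // fineK.
exists ((fine T - clock E v l.+1 0) / rho) => //.
rewrite clockE // -[LHS]fineK //; congr (_%:E); field.
exact: r0.
Qed.
End OneNode.

(** * Re-running an execution with fewer faults *)

Definition rerun_with (R : realType) (V : finType) (E : execution R V)
    (F : set (V * nat)) (pu : V -> nat -> nat -> R) : execution R V :=
  Execution F (delay E) (clock E) (message E) pu.

(* The division inverts the clock, which is affine. *)
Fixpoint rerun_pulse (R : realType) (V : finType) (e : rel V) (p : params R)
    (E : execution R V) (F : set (V * nat)) (l : nat) (v : V) (k : nat) : R :=
  if l is l'.+1 then
    let E' := rerun_with E F (fun w _ => rerun_pulse e p E F l' w) in
    (fine (pulse_target e p E' v l' k) - clock E v l 0)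
      / (clock E v l 1 - clock E v l 0)
  else pulse E v 0 k.

Definition rerun (R : realType) (V : finType) (e : rel V) (p : params R)
    (E : execution R V) (F : set (V * nat)) : execution R V :=
  rerun_with E F (fun v l => rerun_pulse e p E F l v).

Section Executions.
Context {R : realType} {V : finType} (e : rel V) (p : params R).
Hypothesis bg_e : base_graph e.
Hypothesis valid_p : valid_params p.

Lemma neighbour_neq v w0 : exists2 w, e v w & w != w0.
Proof.
have [_ _ _ /(_ v) deg] := bg_e.
have : (0 < #|[set w | e v w]%SET :\ w0|)%N.
  have := cardsD1 w0 [set w | e v w]%SET.
  by case: (_ \in _) => E; move: deg; rewrite E; case: #|_|.
by case/card_gt0P => w; rewrite !inE => /andP[nw evw]; exists w.
Qed.

Lemma reception_ge0 (E : execution R V) v l k w :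
  (forall v w l, pred_of e v w ->
     max_delay p - uncertainty p <= delay E w v l <= max_delay p) ->
  (forall v w l k, pred_of e v w -> faulty E (w, l) ->
     (0 <= message E w v l k)%E) ->
  (forall v k, ~ faulty E (v, l) -> 0 <= pulse E v l k) ->
  pred_of e v w -> (0 <= reception E v l k w)%E.
Proof.
have [u0 ud _ _] := valid_p.
move=> Hd Hm Hp vw; rewrite /reception; case: ifPn => [|/negP nF].
  by rewrite inE => F; apply: Hm.
rewrite lee_fin addr_ge0 //; first by apply: Hp => F; apply: nF; rewrite inE.
by have /andP[d1 _] := Hd v w l vw; apply: le_trans d1; rewrite subr_ge0.
Qed.

Lemma only_faulty_pred (E : execution R V) v l :
  is_subset1 ([set (w, l) | w in pred_of e v] `&` faulty E) ->
  exists w0, forall w, pred_of e v w -> w != w0 -> ~ faulty E (w, l).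
Proof.
move=> H; have [[w0 [vw0 Fw0]]|nF] :=
  pselect (exists w0, pred_of e v w0 /\ faulty E (w0, l)).
  exists w0 => w vw nw Fw; move/eqP: nw; apply.
  suff [] : (w, l) = (w0, l) by [].
  by apply: H; split => //; [exists w | exists w0].
(* Without a faulty predecessor the choice of [w0] is arbitrary. *)
by exists v => w vw _ Fw; apply: nF; exists w.
Qed.

Lemma reception_correct (E : execution R V) v l k w :
  ~ faulty E (w, l) -> reception E v l k w = (pulse E w l k + delay E w v l)%:E.
Proof. by rewrite /reception => nF; case: ifPn => //; rewrite inE. Qed.

Lemma rerun_valid (E : execution R V) (F : set (V * nat)) :
  valid_execution e p E -> F `<=` faulty E ->
  (forall v, ~ faulty E (v, 0%N)) ->
  3 / 2 * kappa p <= Lambda p - max_delay p ->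
  valid_execution e p (rerun e p E F).
Proof.
move=> [E1 E2 E3 E4 [E5 E6]] FE nF0 Lam.
have [u0 ud th1 k0] := valid_p; have [_ irr_e _ _] := bg_e.
have V1 v l : is_subset1 ([set (w, l) | w in pred_of e v] `&` F).
  by move=> x y [xv xF] [yv yF]; apply: (E1 v l); split => //; exact: FE.
have V4 v w l k : pred_of e v w -> F (w, l) -> (0 <= message E w v l k)%E.
  by move=> vw Fw; apply: E4 => //; exact: FE.
have step l : (forall v k, ~ F (v, l) -> 0 <= rerun_pulse e p E F l v k) ->
    forall v k, 0 <= rerun_pulse e p E F l.+1 v k /\
      follows_algorithm e p (rerun e p E F) v l k.
  move=> IH v k.
  have [rho /andP[rho1 rho2] Hrho] := hardware_clock_affine (E3 v l.+1).
  have [w0 Hw0] := only_faulty_pred (E := rerun e p E F) (V1 v l).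
  have [t t0 Ht] : exists2 t, 0 <= t &
      pulse_target e p (rerun e p E F) v l k = (clock E v l.+1 t)%:E.
    apply: (@pulse_target_clock _ _ _ _ _ _ _ _ rho w0) => //.
    - by lra.
    - by lra.
    - by move=> w; apply: reception_ge0.
    - exact: neighbour_neq.
    - by move=> w vw nw; rewrite reception_correct ?ltry //; exact: Hw0.
  have tE : rerun_pulse e p E F l.+1 v k = t.
    (* This holds by conversion: the target reads pulses of layer [l] only, so the auxiliary
       execution in [rerun_pulse] may ignore the layer. *)
    have -> : rerun_pulse e p E F l.+1 v k =
        (fine (pulse_target e p (rerun e p E F) v l k) - clock E v l.+1 0)
          / (clock E v l.+1 1 - clock E v l.+1 0) by [].
    rewrite Ht [fine _]/= (Hrho t t0) (Hrho 1 ler01).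
    by field; lra.
  by split; [rewrite tE | rewrite /follows_algorithm [pulse _ _ _ _]tE -Ht].
have pos l v k : ~ F (v, l) -> 0 <= rerun_pulse e p E F l v k.
  elim: l v k => [|l IH] v k nF; last by have [] := step l IH v k.
  by apply: E5; exact: nF0.
split => //; split; first by move=> v l k; exact: pos.
by move=> v l k _; have [] := step l (pos l) v k.
Qed.

Lemma rerun_faults_removed (E : execution R V) (F : set (V * nat)) :
  F `<=` faulty E -> some_faults_removed E (rerun e p E F).
Proof. by split. Qed.

End Executions.

(** * Skew bounds *)

Section Skew.
Context {R : realType} {V : finType} (e : rel V) (p : params R).
Hypothesis bg_e : base_graph e.
Hypothesis valid_p : valid_params p.

Lemma valid_pulse_le (E : execution R V) v l k :
  valid_execution e p E -> ~ faulty E (v, l.+1) ->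
  forall rho, 0 < rho ->
  (forall t, 0 <= t -> clock E v l.+1 t = clock E v l.+1 0 + rho * t) ->
  forall y, pulse E v l.+1 k <= y + (Lambda p - max_delay p) / rho <->
    fires_by e (theta p) (kappa p / rho) v (reception E v l k) y.
Proof.
move=> [E1 E2 E3 E4 [E5 E6]] nF rho rho0 clockE y.
have [u0 ud th1 k0] := valid_p; have [_ irr_e _ _] := bg_e.
have [w0 Hw0] := only_faulty_pred (E1 v l).
apply: (@pulse_le _ _ _ _ _ _ _ _ rho w0) => //.
- by lra.
- by move=> w; apply: (reception_ge0 valid_p) => // ? ?; apply: E5.
- exact: (neighbour_neq bg_e).
- by move=> w vw nw; rewrite reception_correct ?ltry //; exact: Hw0.
- exact: E5.
- exact: E6.
Qed.

Lemma pulse_nonexpansive (E1 E2 : execution R V) v l k x :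
  valid_execution e p E1 -> valid_execution e p E2 ->
  clock E1 = clock E2 ->
  ~ faulty E1 (v, l.+1) -> ~ faulty E2 (v, l.+1) ->
  (forall w c, pred_of e v w -> (reception E2 v l k w <= c%:E)%E ->
     (reception E1 v l k w <= (c + x)%:E)%E) ->
  pulse E1 v l.+1 k <= pulse E2 v l.+1 k + x.
Proof.
move=> V1 V2 cl nF1 nF2 Hx.
have [_ _ Ecl _ _] := V1.
have [rho /andP[rho1 _] Hrho] := hardware_clock_affine (Ecl v l.+1).
have rho0 : 0 < rho by lra.
have P1 := valid_pulse_le k V1 nF1 rho0 Hrho.
have P2 := valid_pulse_le k V2 nF2 rho0.
rewrite -cl in P2; move/(_ Hrho): P2 => P2.
set c := (_ / rho) in P1 P2.
suff /P1 : fires_by e (theta p) (kappa p / rho) v (reception E1 v l k)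
    (pulse E2 v l.+1 k - c + x) by lra.
have : fires_by e (theta p) (kappa p / rho) v (reception E2 v l k)
    (pulse E2 v l.+1 k - c) by apply/P2; lra.
apply: (fires_by_mono (f := fun y => y + x)) => a w vw.
by move=> /(Hx _ _ vw); rewrite addrAC.
Qed.

(** Confines the output by the inputs other than the one from [w0], whatever [w0] sends; this is
    what limits the effect of a fault. *)
Lemma pulse_range (E : execution R V) v l k w0 (a b rho : R) :
  valid_execution e p E -> theta p <= 2 -> ~ faulty E (v, l.+1) ->
  1 <= rho ->
  (forall t, 0 <= t -> clock E v l.+1 t = clock E v l.+1 0 + rho * t) ->
  (forall w, pred_of e v w -> w != w0 -> ~ faulty E (w, l)) ->
  (forall w, pred_of e v w -> w != w0 ->
     a <= pulse E w l k + delay E w v l <= b) ->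
  a - 2 * kappa p <= pulse E v l.+1 k - (Lambda p - max_delay p) / rho
    <= b + 3 / 2 * kappa p.
Proof.
move=> VE th2 nF rho1 clockE Hw0 Hab.
have [u0 ud th1 k0] := valid_p; have [_ irr_e _ _] := bg_e.
have rho0 : 0 < rho by lra.
have lam0 : 0 <= kappa p / rho by rewrite divr_ge0 // ltW.
have lamk : kappa p / rho <= kappa p.
  by rewrite ler_pdivrMr // ler_peMr // ltW.
have P := valid_pulse_le k VE nF rho0 clockE.
set c := (_ / rho) in P *.
apply/andP; split.
  have /P/fires_by_range_ge : pulse E v l.+1 k <= pulse E v l.+1 k - c + c by lra.
  move=> /(_ irr_e w0 a lam0 th2 (neighbour_neq bg_e v w0)) H.
  suff : a - 2 * (kappa p / rho) <= pulse E v l.+1 k - c by lra.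
  apply: H => w vw nw; rewrite reception_correct; last exact: Hw0.
  by rewrite lee_fin; have /andP[] := Hab w vw nw.
suff /P : fires_by e (theta p) (kappa p / rho) v (reception E v l k)
    (b + 3 / 2 * (kappa p / rho)) by lra.
apply: (fires_by_range_le irr_e lam0 _ (neighbour_neq bg_e v w0)); first by lra.
move=> w vw nw; rewrite reception_correct; last exact: Hw0.
by rewrite lee_fin; have /andP[] := Hab w vw nw.
Qed.

(** Here [q] is [1 - 1 / theta p] and [lr] is the supremal skew. Since [kappa p] is at least
    [2 * q * (Lambda p - max_delay p)] and the wait is at least [16 * lr], the product [q * lr] is
    at most [kappa p / 32]. *)
Lemma parameter_facts (E : execution R V) (x0 : V) :
  parameter_bounds e p 16 E -> (forall v, ~ faulty E (v, 0%N)) ->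
  [/\ theta p <= 17 / 16,
      3 / 2 * kappa p <= Lambda p - max_delay p &
      exists q lr : R, [/\ 0 <= q <= 1 / 16, theta p * (1 - q) = 1,
        q * lr <= kappa p / 32,
        kappa p = 2 * (uncertainty p + q * (Lambda p - max_delay p)) &
        forall l k v w, e v w -> ~ faulty E (v, l) -> ~ faulty E (w, l) ->
          `|pulse E v l k - pulse E w l k| <= lr]].
Proof.
have [u0 ud th1 k0] := valid_p.
move=> [B1 B2 B3] nF0.
set Lsup := ereal_sup _ in B1 B2.
have LsupP l k v w : e v w -> ~ faulty E (v, l) -> ~ faulty E (w, l) ->
    (`|pulse E v l k - pulse E w l k|%:E <= Lsup)%E.
  move=> evw nv nw; apply: (@le_trans _ _ (layer_skew e E l)).
    by apply: ereal_sup_ubound; exists k, v, w.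
  by apply: ereal_sup_ubound; exists l.
have [y x0y _] := neighbour_neq bg_e x0 x0.
have Lsup0 : (0 <= Lsup)%E.
  apply: le_trans (LsupP 0%N 0%N _ _ x0y (nF0 _) (nF0 _)).
  by rewrite lee_fin.
case: Lsup Lsup0 B1 B2 LsupP => [lr|_|//]; last first.
  by rewrite addye // gt0_muley ?lte_fin ?mulr_gt0 //; last by lra.
rewrite -EFinD -!EFinM !lee_fin => lr0 B1 B2 LsupP.
have th0 : 0 < theta p by lra.
have tl : lr + uncertainty p <= theta p * (lr + uncertainty p).
  by rewrite ler_peMl ?addr_ge0 // ltW.
have d0 : 0 < max_delay p.
  by lra.
have th16 : theta p <= 17 / 16.
  have : (theta p - 1) * 16 * max_delay p <= 1 * max_delay p by lra.
  by rewrite ler_pM2r //; lra.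
pose q := 1 - (theta p)^-1.
have thq : theta p * (1 - q) = 1 by rewrite /q opprB addrC subrK mulfV // gt_eqF.
have q0 : 0 <= q by rewrite /q subr_ge0 invf_le1 // ltW.
have q1 : q <= 1 / 16.
  rewrite -(ler_pM2l th0); move: thq; rewrite mulrBr mulr1 => thq.
  by lra.
have kE : kappa p = 2 * (uncertainty p + q * (Lambda p - max_delay p)) by [].
have qL : q * (16 * (lr + uncertainty p)) <= q * (Lambda p - max_delay p).
  by rewrite ler_wpM2l //; lra.
have qu : 0 <= q * uncertainty p by rewrite mulr_ge0.
have qL2 : (Lambda p - max_delay p) * q <= (Lambda p - max_delay p) * (1 / 16).
  by rewrite ler_wpM2l //; lra.
split => //; first by lra.
by exists q, lr; split => //; [rewrite q0 | lra].
Qed.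

Lemma fault_free_skew (E : execution R V) (s l k : nat) v w :
  valid_execution e p E -> parameter_bounds e p 16 E ->
  (forall x, ~ faulty E x) ->
  (forall v w, e v w -> pulse E v 0%N k - pulse E w 0%N k <= kappa p) ->
  (4 * diameter e + 2 <= 2 ^ s)%N -> e v w ->
  pulse E v l k - pulse E w l k <= 4 * (s%:R + 1) * kappa p.
Proof.
move=> VE PE nF L0 Ds evw.
have [u0 ud th1 k0] := valid_p; have [sym_e irr_e con_e _] := bg_e.
have [th17 Lam [q [lr [q01 thq qlr kE lrP]]]] :=
  parameter_facts v PE (fun v => nF (v, 0%N)).
have /andP[q0 q1] := q01.
have th0 : 0 < theta p by lra.
have [_ Edel Ecl _ _] := VE.
pose tau l v := pulse E v l k - l%:R * Lambda p.
have deg x : exists y, e x y.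
  by have [y exy _] := neighbour_neq bg_e x x; exists y.
have -> : pulse E v l k - pulse E w l k = tau l v - tau l w by rewrite /tau; ring.
apply: (@neighbour_skew _ _ e (graph_dist e) (diameter e)) => //.
- exact: graph_distP.
- exact: graph_dist_sym.
- exact: graph_dist_diameter.
- move=> {}l.
  have /choice[rho Hrho] : forall x, exists rho, 1 <= rho <= theta p /\
      forall t, 0 <= t -> clock E x l.+1 t = clock E x l.+1 0 + rho * t.
    by move=> x; have [rho] := hardware_clock_affine (Ecl x l.+1); exists rho.
  have rho0 x : 0 < rho x by have [/andP[r1 _] _] := Hrho x; lra.
  pose sig x y := pulse E y l k + delay E y x l + (Lambda p - max_delay p) / rho x
    - l.+1%:R * Lambda p.
  have rhoV x : 1 - q <= (rho x)^-1 <= 1.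
    have [/andP[r1 r2] _] := Hrho x.
    rewrite invf_le1 // r1 andbT -(ler_pM2l (rho0 x)) mulfV ?gt_eqF //.
    by rewrite -[leRHS]thq ler_wpM2r // subr_ge0; lra.
  apply: (@gradient_step_fires_by _ _ _ (theta p) _ q lr _ _
    (fun x => kappa p / rho x) sig) => //.
  + move=> x y exy; rewrite /tau opprD opprK addrACA addNr addr0.
    exact: lrP.
  + move=> x; have /andP[r1 r2] := rhoV x.
    rewrite ler_wpM2l ?(ltW k0) //=.
    by rewrite -[leRHS]mulr1 ler_wpM2l // ltW.
  (* Delay uncertainty and clock drift together move an input by at most [u + q * (Lambda - d)],
     which is exactly [kappa p / 2]. *)
  + move=> x y xy; have /andP[d1 d2] := Edel x y l xy.
    have /andP[r1 r2] := rhoV x.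
    have L0' : 0 <= Lambda p - max_delay p by lra.
    have := ler_wpM2l L0' r1; have := ler_wpM2l L0' r2.
    rewrite /sig /tau -[l.+1%:R]natr1 => H1 H2.
    by apply/andP; split; lra.
  + move=> x y; have [_ Hcl] := Hrho x.
    have P := valid_pulse_le k VE (nF (x, l.+1)) (rho0 x) Hcl.
    set c := (Lambda p - max_delay p) / rho x in P.
    pose c' := c - l.+1%:R * Lambda p.
    have shift z a : pred_of e x z ->
        ((EFin \o sig x) z <= (y + a)%:E)%E =
        (reception E x l k z <= (y - c' + a)%:E)%E.
      move=> xz; rewrite reception_correct; last exact: nF.
      by rewrite !lee_fin /sig -/c /c'; apply/idP/idP; lra.
    have -> : tau l.+1 x <= y <-> pulse E x l.+1 k <= y - c' + c.
      by rewrite /tau /c'; split; lra.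
    rewrite P; split.
      move=> H; rewrite -[y](subrK c').
      move: H; apply: (fires_by_mono (f := fun z => z + c')) => a z xz.
      by rewrite addrAC subrK shift // addrAC.
    apply: (fires_by_mono (f := fun z => z - c')) => a z xz.
    by rewrite shift.
- by move=> x y exy; rewrite /tau !mul0r !subr0; apply: L0.
Qed.

(** The executions agree up to layer [l0], differ by at most [2 * A + 4 * kappa p] in the next
    layer, and drift no further apart afterwards. Two such differences plus [A] give the bound. *)
Lemma skew_after_fault (E : execution R V) v0 l0 (A : R) :
  valid_execution e p E -> parameter_bounds e p 16 E ->
  (forall v, ~ faulty E (v, 0%N)) -> faulty E (v0, l0) ->
  let E' := rerun e p E (faulty E `\ (v0, l0)) in
  (forall l k v w, e v w -> ~ faulty E' (v, l) -> ~ faulty E' (w, l) ->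
    `|pulse E' v l k - pulse E' w l k| <= A) ->
  forall l k v w, e v w -> ~ faulty E (v, l) -> ~ faulty E (w, l) ->
    `|pulse E v l k - pulse E w l k| <= 5 * A + 8 * kappa p.
Proof.
move=> VE PE nF0 F0 E' HA.
have [u0 ud th1 k0] := valid_p; have [sym_e irr_e con_e _] := bg_e.
have [th17 Lam [q [lr [/andP[q0 _] _ _ kE _]]]] := parameter_facts v0 PE nF0.
have uk : uncertainty p <= kappa p / 2.
  have : 0 <= q * (Lambda p - max_delay p) by rewrite mulr_ge0 //; lra.
  by lra.
have FE' : faulty E' `<=` faulty E by move=> x [].
have VE' : valid_execution e p E' by apply: rerun_valid.
have [E1 Edel Ecl _ _] := VE.
have nF' v l : ~ faulty E (v, l) -> ~ faulty E' (v, l) by move=> nF /FE'.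
have A0 : 0 <= A.
  have [y vy _] := neighbour_neq bg_e v0 v0.
  by apply: le_trans (HA 0%N 0%N _ _ vy (nF' _ _ (nF0 _)) (nF' _ _ (nF0 _))).
have nonexp l k v x : 0 <= x -> ~ faulty E (v, l.+1) ->
    (forall w, pred_of e v w -> (w, l) <> (v0, l0)) ->
    (forall w, ~ faulty E (w, l) -> `|pulse E w l k - pulse E' w l k| <= x) ->
    `|pulse E v l.+1 k - pulse E' v l.+1 k| <= x.
  move=> x0 nF vw0 IH.
  (* A predecessor that is faulty in both executions sends the same message in both. *)
  have rec w : pred_of e v w -> reception E v l k w = reception E' v l k w \/
      exists r r', [/\ reception E v l k w = r%:E, reception E' v l k w = r'%:E
        & `|r - r'| <= x].
    move=> vw; have [Fw|nFw] := pselect (faulty E (w, l)).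
      have Fw' : faulty E' (w, l) by split => //; exact: vw0.
      left; rewrite /reception.
      by move/mem_set : Fw => ->; move/mem_set : Fw' => ->.
    right; rewrite !reception_correct //; last exact: nF'.
    do 2 eexists; split; [reflexivity|reflexivity|].
    by rewrite opprD addrACA subrr addr0; apply: IH.
  suff [H1 H2] : pulse E v l.+1 k <= pulse E' v l.+1 k + x /\
      pulse E' v l.+1 k <= pulse E v l.+1 k + x.
    by rewrite ler_norml; apply/andP; split; lra.
  split; apply: pulse_nonexpansive => //; try exact: nF'.
    move=> w c vw; have [->|[r [r' [-> ->]]]] := rec w vw.
      by move=> /le_trans; apply; rewrite lee_fin lerDl.
    by rewrite !lee_fin ler_norml => /andP[]; lra.
  move=> w c vw; have [->|[r [r' [-> ->]]]] := rec w vw.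
    by move=> /le_trans; apply; rewrite lee_fin lerDl.
  by rewrite !lee_fin ler_norml => /andP[]; lra.
have before l k v : (l <= l0)%N -> ~ faulty E (v, l) ->
    pulse E v l k = pulse E' v l k.
  elim: l v => [//|l IH] v ll0 nF.
  apply/eqP; rewrite -subr_eq0 -normr_le0; apply: nonexp => //.
    by move=> w _ [_ ll]; rewrite ll ltnn in ll0.
  by move=> w nw; rewrite IH ?subrr ?normr0 // ltnW.
have diff l k v : ~ faulty E (v, l) ->
    `|pulse E v l k - pulse E' v l k| <= 2 * A + 4 * kappa p.
  have x0 : 0 <= 2 * A + 4 * kappa p by lra.
  elim: l v => [|l IH] v nF; first by rewrite before // subrr normr0.
  have [[vv0 ll0]|nvl] := pselect (pred_of e v v0 /\ l = l0); last first.
    apply: nonexp => // w vw [wE lE]; apply: nvl; split => //.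
    by rewrite -wE.
  rewrite {}ll0 in nF IH *.
  have [rho /andP[rho1 _] Hrho] := hardware_clock_affine (Ecl v l0.+1).
  have nFw w : pred_of e v w -> w != v0 -> ~ faulty E (w, l0).
    move=> vw nw Fw; move/eqP: nw; apply.
    suff [] : (w, l0) = (v0, l0) by [].
    by apply: (E1 v l0); split => //; [exists w | exists v0].
  have vv : pred_of e v v by rewrite /pred_of eqxx.
  have nFv : ~ faulty E' (v, l0).
    have [->|nv] := eqVneq v v0; first by move=> [_]; apply.
    by apply: nF'; exact: nFw.
  (* In [E'] the node [(v, l0)] is correct even if [v] is [v0], so its pulse is a common reference
     for the other predecessors. *)
  pose m := pulse E' v l0 k.
  have Hm w : pred_of e v w -> w != v0 -> `|m - pulse E' w l0 k| <= A.
    move=> vw nw; have [->|nwv] := eqVneq w v; first by rewrite subrr normr0.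
    apply: HA => //; last by apply: nF'; exact: nFw.
    by move: vw; rewrite /pred_of (negbTE nwv).
  pose a := m - A + max_delay p - uncertainty p.
  pose b := m + A + max_delay p.
  have Hab w : pred_of e v w -> w != v0 ->
      a <= pulse E' w l0 k + delay E w v l0 <= b.
    move=> vw nw; have := Hm w vw nw; rewrite ler_norml => /andP[m1 m2].
    have /andP[d1 d2] := Edel v w l0 vw.
    by rewrite /a /b; apply/andP; split; lra.
  have th2 : theta p <= 2 by lra.
  have /andP[R1 R2] : a - 2 * kappa p <=
      pulse E v l0.+1 k - (Lambda p - max_delay p) / rho <= b + 3 / 2 * kappa p.
    apply: (pulse_range VE th2 nF rho1 Hrho nFw) => w vw nw.
    by rewrite before //; [exact: Hab | exact: nFw vw nw].
  have /andP[R3 R4] : a - 2 * kappa p <=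
      pulse E' v l0.+1 k - (Lambda p - max_delay p) / rho <= b + 3 / 2 * kappa p.
    apply: (pulse_range VE' th2 _ rho1 Hrho) Hab; first exact: nF'.
    by move=> w vw nw; apply: nF'; exact: nFw.
  (* Both pulses lie in one interval, of length [2 * A + u + 7 / 2 * kappa p], and
     [u <= kappa p / 2]. *)
  rewrite ler_norml; move: R1 R2 R3 R4; set c := _ / rho; rewrite /a /b.
  by move=> *; apply/andP; split; lra.
move=> l k v w evw nv nw.
have := HA l k v w evw (nF' _ _ nv) (nF' _ _ nw).
have := diff l k v nv; have := diff l k w nw.
rewrite !ler_norml => /andP[a1 a2] /andP[b1 b2] /andP[c1 c2].
by apply/andP; split; lra.
Qed.

End Skew.

(** * Induction over the faults and the final bound *)

Lemma trunc_log_le_log2 (R : realType) (D : nat) : (2 <= D)%N ->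
  (1 <= trunc_log 2 D)%N /\ (trunc_log 2 D)%:R <= log2 (D%:R : R).
Proof.
move=> D2; split; first by apply: trunc_log_max.
have ln2 : 0 < ln (2 : R) by rewrite ln_gt0 // ltr1n.
rewrite /log2 ler_pdivlMr // mulr_natl -lnXn //.
rewrite ler_ln ?posrE ?exprn_gt0 ?ltr0n //; last by lia.
by rewrite -natrX ler_nat trunc_logP //; lia.
Qed.

Lemma some_faults_removed_trans (R : realType) (V : finType)
    (E E' E'' : execution R V) : (forall v, ~ faulty E (v, 0%N)) ->
  some_faults_removed E E' -> some_faults_removed E' E'' ->
  some_faults_removed E E''.
Proof.
move=> nF0 [F1 d1 c1 m1 p1] [F2 d2 c2 m2 p2]; split.
- by move=> x /F2/F1.
- by rewrite d2.
- by rewrite c2.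
- by rewrite m2.
- by move=> v k nF; rewrite p2 ?p1 // => /F1.
Qed.

(** Induction on a list covering the faults, re-running without its first entry. The offset [- 3]
    absorbs the additive term: [5 * (27 * x - 3) + 8 <= 27 * (5 * x) - 3]. *)
Lemma few_faults_skew (R : realType) (V : finType) (e : rel V) (p : params R)
    (s : seq (V * nat)) (E : execution R V) :
  base_graph e -> valid_params p -> (2 <= diameter e)%N ->
  valid_execution e p E ->
  (forall E' : execution R V, valid_execution e p E' ->
     some_faults_removed E E' -> parameter_bounds e p 16 E') ->
  (forall x, faulty E x -> x \in s) -> (forall v, ~ faulty E (v, 0%N)) ->
  (forall k v w, e v w -> `|pulse E v 0%N k - pulse E w 0%N k| <= kappa p) ->
  forall l k v w, e v w -> ~ faulty E (v, l) -> ~ faulty E (w, l) ->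
    `|pulse E v l k - pulse E w l k|
      <= (27 * 5 ^+ size s - 3) * (kappa p * log2 (diameter e)%:R).
Proof.
move=> bg_e valid_p D2.
have [_ _ th1 k0] := valid_p; have [sym_e _ _ _] := bg_e.
have [n1 nld] := trunc_log_le_log2 R D2.
set n := trunc_log 2 _ in n1 nld; set ld := log2 _ in nld *.
have n1' : 1 <= n%:R :> R by rewrite ler1n.
have kld : kappa p <= kappa p * ld by rewrite ler_peMr ?(ltW k0) //; lra.
have refl (E1 : execution R V) : some_faults_removed E1 E1 by split.
elim: s E => [|[v0 l0] s IH] E VE PE Fs nF0 L0 l k v w evw nv nw.
  have nF x : ~ faulty E x by move/Fs.
  have L0' k' x y : e x y -> pulse E x 0%N k' - pulse E y 0%N k' <= kappa p.
    by move=> exy; apply: le_trans (ler_norm _) (L0 _ _ _ exy).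
  (* Level [n + 4] yields the factor [4 * (n + 5)], at most [24 * n] as [n >= 1], and [24] is
     [27 * 5 ^+ 0 - 3]. *)
  have Dn : (4 * diameter e + 2 <= 2 ^ (n + 4))%N.
    have := trunc_log_ltn (diameter e) (isT : 1 < 2)%N.
    by rewrite -/n expnS expnD; lia.
  have H x y : e x y -> pulse E x l k - pulse E y l k
      <= (27 * 5 ^+ 0 - 3) * (kappa p * ld).
    move=> exy; rewrite expr0.
    have := fault_free_skew bg_e valid_p l VE (PE _ VE (refl _)) nF (L0' k) Dn exy.
    rewrite natrD; have := ler_wpM2l (ltW k0) nld; have := ler_wpM2l (ltW k0) n1'.
    by lra.
  have ewv : e w v by rewrite sym_e.
  rewrite ler_norml; have := H _ _ evw; have := H _ _ ewv.
  by move=> *; apply/andP; split; lra.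
have pow1 : 1 <= 5 ^+ size s :> R by rewrite exprn_ege1 // ler1n.
have kld0 : 0 <= kappa p * ld by apply: le_trans kld; apply: ltW.
rewrite /= exprS.
(* The list may contain correct nodes; such an entry is skipped. *)
have [F0|nFx] := pselect (faulty E (v0, l0)); last first.
  have Fs' x : faulty E x -> x \in s.
    move=> Fx; have := Fs x Fx; rewrite inE => /predU1P[xE|//].
    by rewrite xE in Fx.
  apply: (le_trans (IH E VE PE Fs' nF0 L0 _ _ _ _ evw nv nw)).
  by rewrite ler_wpM2r //; lra.
set E' := rerun e p E (faulty E `\ (v0, l0)).
have FE' : faulty E `\ (v0, l0) `<=` faulty E by move=> x [].
have [_ Lam _] := parameter_facts bg_e valid_p v0 (PE _ VE (refl _)) nF0.
have VE' : valid_execution e p E' by exact: rerun_valid.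
have EE' : some_faults_removed E E' by exact: rerun_faults_removed.
have PE' E'' : valid_execution e p E'' -> some_faults_removed E' E'' ->
    parameter_bounds e p 16 E''.
  by move=> V2 /(some_faults_removed_trans nF0 EE'); exact: PE.
have Fs' x : faulty E' x -> x \in s.
  move=> [Fx xn]; have := Fs x Fx; rewrite inE => /predU1P[//|//].
have nF0' x : ~ faulty E' (x, 0%N) by move=> /FE'/nF0.
apply: (le_trans (skew_after_fault bg_e valid_p VE (PE _ VE (refl _)) nF0 F0
  (IH E' VE' PE' Fs' nF0' L0) _ evw nv nw)).
by lra.
Qed.

Lemma card_le_seq (T : choiceType) (A : set T) n : A #<= `I_n ->
  exists2 s : seq T, (forall x, A x -> x \in s) & (size s <= n)%N.
Proof.
move=> An; have finA : finite_set A by apply/finite_set_leP; exists n.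
exists (finmap.enum_fset (fset_set A)); last exact: geq_card_fset_set.
by move=> x Ax; have := in_fset_set finA x; rewrite mem_set.
Qed.

Theorem theorem1p2 (R : realType) :
  exists (C0 C : R) (D0 : nat), [/\ 0 < C0, 0 < C &
    forall (V : finType) (e : rel V) (D : nat) (p : params R)
        (E : execution R V) (f : nat),
      base_graph e -> diameter e = D -> (0 < D)%N -> (D0 <= D)%N ->
      valid_params p -> valid_execution e p E ->
      (layer_skew e E 0 <= (kappa p)%:E)%E ->
      (forall E' : execution R V,
         valid_execution e p E' -> some_faults_removed E E' ->
         parameter_bounds e p C0 E') ->
      faulty E #<= `I_f ->
      (forall v : V, ~ faulty E (v, 0%N)) ->
      forall l : nat,
        (layer_skew e E l <= (C * 5 ^+ f * kappa p * log2 D%:R)%:E)%E].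
Proof.
(* The threshold [2] makes [log2 D] at least [1], so that additive multiples of [kappa p] are
   absorbed. *)
exists 16, 27, 2%N; split => // V e D p E f bg_e <- _ D2 valid_p VE L0 PE Ff nF0 l.
have [_ _ _ k0] := valid_p.
have [s Fs sf] := card_le_seq Ff.
have L0' k v w : e v w -> `|pulse E v 0%N k - pulse E w 0%N k| <= kappa p.
  move=> evw; rewrite -lee_fin; apply: le_trans L0.
  by apply: ereal_sup_ubound; exists k, v, w.
apply: ge_ereal_sup => _ [k [v [w [evw nv nw ->]]]]; rewrite lee_fin.
apply: (le_trans (few_faults_skew bg_e valid_p D2 VE PE Fs nF0 L0' k evw nv nw)).
have [n1 nld] := trunc_log_le_log2 R D2.
have kld : 0 <= kappa p * log2 (diameter e)%:R.
  by rewrite mulr_ge0 ?(ltW k0) //; apply: le_trans nld.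
rewrite -[leRHS]mulrA ler_wpM2r // lerBlDr.
have : 5 ^+ size s <= 5 ^+ f :> R by rewrite ler_eXn2l ?ltr1n.
by lra.
Qed.
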